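(* Let $G_{40}$ be the graph on vertex set $\{0,1,\ldots,39\}$ with exactly the following $54$ edges: $0\text{-}1$, $0\text{-}2$, $0\text{-}39$, $1\text{-}3$, $1\text{-}12$, $2\text{-}3$, $2\text{-}4$, $3\text{-}5$, $4\text{-}6$, $5\text{-}6$, $5\text{-}7$, $6\text{-}8$, $7\text{-}9$, $7\text{-}10$, $8\text{-}9$, $8\text{-}10$, $11\text{-}12$, $11\text{-}13$, $11\text{-}22$, $12\text{-}14$, $13\text{-}14$, $13\text{-}15$, $14\text{-}16$, $15\text{-}17$, $16\text{-}17$, $16\text{-}18$, $17\text{-}19$, $18\text{-}20$, $18\text{-}21$, $19\text{-}20$, $19\text{-}21$, $22\text{-}24$, $22\text{-}30$, $23\text{-}25$, $23\text{-}30$, $24\text{-}25$, $24\text{-}26$, $25\text{-}27$, $26\text{-}28$, $26\text{-}29$, $27\text{-}28$, $27\text{-}29$, $30\text{-}31$, $31\text{-}32$, $31\text{-}39$, $32\text{-}34$, $33\text{-}34$, $33\text{-}35$, $33\text{-}39$, $34\text{-}36$, $35\text{-}37$, $35\text{-}38$, $36\text{-}37$, $36\text{-}38$. Then $G_{40}$ is subcubic (maximum degree at most $3$), $2$-connected, has no $K_4$ minor, and has no crumby coloring.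
   Context: A red-blue coloring of the vertices of a graph is called crumby if (1) the subgraph induced by the blue vertices has maximum degree at most $1$, (2) every red vertex has at least one red neighbour, and (3) the subgraph induced by the red vertices contains no path on four vertices as a subgraph (not necessarily induced), i.e., there are no four distinct red vertices $v_1,v_2,v_3,v_4$ with $v_1v_2,v_2v_3,v_3v_4$ edges. *)

(* Defs.v *)
From mathcomp Require Import all_boot.
Set Implicit Arguments.
Unset Strict Implicit.
Unset Printing Implicit Defensive.

Record sgraph := SGraph {
  vertex :> finType;
  adj : rel vertex;
  adj_sym : symmetric adj;
  adj_irr : irreflexive adj
}.
Arguments adj {s} x y.

Section Graphs.
Variable G : sgraph.

Definition deg (v : G) : nat := #|[set w : G | adj v w]|.

Definition max_degree : nat := \max_(v : G) deg v.

Definition subcubic : Prop := max_degree <= 3.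

(* The graph with no vertices is not connected. *)
Definition connected : Prop :=
  0 < #|G| /\ forall x y : G, connect (@adj G) x y.

Section Induced.
Variable S : {set G}.

Definition induced_adj : rel {x : G | x \in S} :=
  fun x y => adj (val x) (val y).

Lemma induced_adj_sym : symmetric induced_adj.
Proof. by move=> x y; apply: adj_sym. Qed.

Lemma induced_adj_irr : irreflexive induced_adj.
Proof. by move=> x; apply: adj_irr. Qed.

Definition induced : sgraph := SGraph induced_adj_sym induced_adj_irr.

End Induced.
End Graphs.

(* More than k vertices, and no set of fewer than k vertices separates G. *)
Definition k_connected (k : nat) (G : sgraph) : Prop :=
  k < #|G| /\ forall X : {set G}, #|X| < k -> connected (induced (~: X)).

(* H is a minor of G: there are connected, pairwise disjoint branch sets
   B x of G, one for each vertex x of H, such that adjacent vertices of H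
   have branch sets joined by an edge of G. *)
Definition minor (H G : sgraph) : Prop :=
  exists B : H -> {set G},
    [/\ forall x, connected (induced (B x)),
        forall x y, x != y -> [disjoint B x & B y]
      & forall x y, adj x y ->
          exists u v, [/\ u \in B x, v \in B y & adj u v]].

Section Complete.
Variable n : nat.

Definition complete_adj : rel 'I_n := fun i j => i != j.

Lemma complete_adj_sym : symmetric complete_adj.
Proof. by move=> i j; rewrite /complete_adj eq_sym. Qed.

Lemma complete_adj_irr : irreflexive complete_adj.
Proof. by move=> i; rewrite /complete_adj eqxx. Qed.

Definition complete : sgraph := SGraph complete_adj_sym complete_adj_irr.

End Complete.

Section Crumby.
Variable G : sgraph.

(* A red-blue coloring is given by its set R of red vertices; the blue
   vertices are those of ~: R. *)
Definition crumby (R : {set G}) : Prop :=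
  [/\ max_degree (induced (~: R)) <= 1,
      forall v, v \in R -> exists2 w, w \in R & adj v w
    & ~ exists v1 v2 v3 v4 : G,
        [/\ uniq [:: v1; v2; v3; v4],
            {subset [:: v1; v2; v3; v4] <= R}
          & [/\ adj v1 v2, adj v2 v3 & adj v3 v4]]].

End Crumby.

Definition G40_edges : seq (nat * nat) :=
  [:: (0, 1); (0, 2); (0, 39); (1, 3); (1, 12); (2, 3); (2, 4); (3, 5);
      (4, 6); (5, 6); (5, 7); (6, 8); (7, 9); (7, 10); (8, 9); (8, 10);
      (11, 12); (11, 13); (11, 22); (12, 14); (13, 14); (13, 15); (14, 16);
      (15, 17); (16, 17); (16, 18); (17, 19); (18, 20); (18, 21); (19, 20);
      (19, 21); (22, 24); (22, 30); (23, 25); (23, 30); (24, 25); (24, 26);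
      (25, 27); (26, 28); (26, 29); (27, 28); (27, 29); (30, 31); (31, 32);
      (31, 39); (32, 34); (33, 34); (33, 35); (33, 39); (34, 36); (35, 37);
      (35, 38); (36, 37); (36, 38)].

Definition G40_adj : rel 'I_40 := fun u v =>
  ((val u, val v) \in G40_edges) || ((val v, val u) \in G40_edges).

Lemma G40_adj_sym : symmetric G40_adj.
Proof. by move=> u v; rewrite /G40_adj orbC. Qed.

Lemma G40_adj_irr : irreflexive G40_adj.
Proof.
move=> u; rewrite /G40_adj orbb; apply/negP => Huu.
have /allP/(_ _ Huu) : all (fun p => p.1 != p.2) G40_edges by vm_compute.
by rewrite /= eqxx.
Qed.

Definition G40 : sgraph := SGraph G40_adj_sym G40_adj_irr.

(* Main.v *)
(* An st-numbering certifies 2-connectedness: after deleting a vertex, everything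
   below it still descends to s, everything above it ascends to t, and st is an
   edge. An elimination order of width 2 certifies that there is no K4 minor:
   among four branch sets the one with the lowest top vertex is enclosed by two
   later vertices, which cannot meet the three other branch sets. Crumbiness is
   a conjunction of clauses over the 40 colours, and these are refuted by
   branching with unit propagation. *)
Require Import Defs.
From mathcomp Require Import all_boot.

Set Implicit Arguments.
Unset Strict Implicit.
Unset Printing Implicit Defensive.

(** * Excluding complete minors by small boundaries *)

Section Connectedness.
Variable G : sgraph.
Implicit Types S D : {set G}.

(** Otherwise membership in [D] would be constant along the paths of [induced S]. *)
Lemma induced_cross S D x y :
  connected (induced S) -> x \in S -> y \in S -> x \in D -> y \notin D ->
  exists u v, [/\ u \in S :&: D, v \in S :\: D & adj u v].
Proof.
move=> [_ conS] xS yS xD yND.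
have [/existsP[u /existsP[v /and3P[uSD vSD uv]]] | noedge] :=
  boolP [exists u, exists v, [&& u \in S :&: D, v \in S :\: D & adj u v]].
  by exists u, v.
have stepD (a b : induced S) : adj a b -> val a \in D -> val b \in D.
  move=> ab aD; apply: contraNT noedge => bND.
  apply/existsP; exists (val a); apply/existsP; exists (val b).
  by rewrite !inE aD bND (valP a) (valP b).
have clD : closed (@adj (induced S)) [pred a | val a \in D].
  move=> a b ab; apply/idP/idP; first exact: stepD.
  by apply: stepD; rewrite adj_sym.
have := closed_connect clD (conS (Sub x xS) (Sub y yS)).
by rewrite !inE /= xD (negPf yND).
Qed.

Definition boundary D : {set G} :=
  [set v | v \notin D & [exists u in D, adj u v]].

Lemma mem_boundary D u v : u \in D -> v \notin D -> adj u v -> v \in boundary D.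
Proof. by move=> uD vND uv; rewrite inE vND; apply/exists_inP; exists u. Qed.

(* Take the branch set whose f-largest vertex t is lowest: every other branch
   set touches it and has a vertex above t, so it meets the boundary of D t. *)
Lemma complete_minor_free (f : G -> nat) (D : G -> {set G}) (k : nat) :
    injective f ->
    (forall t, t \in D t) ->
    (forall t u, u \in D t -> f u <= f t) ->
    (forall t u, u \in boundary (D t) -> f t < f u) ->
    (forall t, #|boundary (D t)| <= k) ->
  ~ minor (complete k.+2) G.
Proof.
move=> f_inj tD D_le D_lt D_card [B [conB disB adjB]].
have topB x : exists t, (t \in B x) && [forall u in B x, f u <= f t].
  have [/card_gt0P[[a aB] _] _] := conB x.
  have [t tB t_max] := @arg_maxnP _ a (fun u => u \in B x) f aB.
  by exists t; rewrite tB; apply/forall_inP.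
pose t x := xchoose (topB x).
have tB x : t x \in B x by have /andP[] := xchooseP (topB x).
have t_max x u : u \in B x -> f u <= f (t x).
  by have /andP[_ /forall_inP] := xchooseP (topB x); apply.
have [x _ x_min] := @arg_minnP _ (ord0 : 'I_k.+2) xpredT (f \o t) isT.
have disjoint_mem y z u : u \in B y -> u \in B z -> y = z.
  move=> uy uz; apply/eqP; apply/negPn/negP => /disB/disjoint_setI0/setP/(_ u).
  by rewrite !inE uy uz.
(* [B x] is confined to [D (t x)]: on leaving, it would hit the boundary, which lies above its top
   vertex [t x]. *)
have BxD u : u \in B x -> u \in D (t x).
  move=> uB; apply/negPn/negP => uND.
  have [a [b]] := induced_cross (conB x) (tB x) uB (tD _) uND.
  rewrite !inE => -[/andP[_ aD] /andP[bND bB] ab].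
  have := D_lt _ _ (mem_boundary aD bND ab).
  by rewrite ltnNge t_max.
have meet y : y != x -> exists w, (w \in B y) && (w \in boundary (D (t x))).
  move=> yx.
  have tyND : t y \notin D (t x).
    apply/negP => /D_le ty_le.
    have /f_inj eq_t : f (t y) = f (t x).
      by apply/eqP; rewrite eqn_leq ty_le; apply: x_min.
    by case/eqP: yx; apply: (disjoint_mem _ _ (t y)); rewrite ?tB // eq_t.
  (* If [B y] meets [D (t x)], connectedness takes it across the boundary towards [t y]; if not, the
     edge joining it to [B x] ends on the boundary. *)
  have [/exists_inP[z zB zD] | /exists_inPn noD] :=
    boolP [exists z in B y, z \in D (t x)].
    have [a [b]] := induced_cross (conB y) zB (tB y) zD tyND.
    rewrite !inE => -[/andP[_ aD] /andP[bND bB] ab].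
    by exists b; rewrite bB (mem_boundary aD bND ab).
  have [|a [b [aB bB ab]]] := adjB x y; first by rewrite /= /complete_adj eq_sym.
  by exists b; rewrite bB (mem_boundary (BxD a aB) (noD b bB) ab).
(* The default is taken only at [y = x], which [w_inj] and the final count leave out. *)
pose w y := odflt (t x) [pick v | (v \in B y) && (v \in boundary (D (t x)))].
have wP y : y != x -> (w y \in B y) && (w y \in boundary (D (t x))).
  move=> /meet[v vP]; rewrite /w; case: pickP => [//|/(_ v)].
  by rewrite vP.
have w_inj : {in [set~ x] &, injective w}.
  move=> y z; rewrite !inE => /wP/andP[wy _] /wP/andP[wz _] eq_w.
  by apply: disjoint_mem wy _; rewrite eq_w.
have := D_card (t x); rewrite leqNgt => /negP; apply.
have <- : #|w @: [set~ x]| = k.+1 by rewrite card_in_imset // cardsC1 card_ord.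
apply/subset_leq_card/subsetP => _ /imsetP[y yx ->].
by rewrite !inE in yx; have /andP[] := wP y yx.
Qed.

End Connectedness.

(** * 2-connectedness from an st-numbering *)

Lemma st_numbering_2connected (G : sgraph) (f : G -> nat) (s t : G) :
    2 < #|G| -> injective f -> adj s t ->
    (forall v, v != s -> exists2 w, adj v w & f w < f v) ->
    (forall v, v != t -> exists2 w, adj v w & f v < f w) ->
  k_connected 2 G.
Proof.
move=> G_gt2 f_inj st down up; split=> // X X_lt2.
have symX : connect_sym (@adj (induced (~: X))).
  by apply: sym_connect_sym; apply: adj_sym.
split.
  have /card_gt0P[v vX] : 0 < #|~: X|.
    rewrite -(ltn_add2l #|X|) addn0 cardsC.
    exact: leq_trans X_lt2 (ltnW G_gt2).
  by apply/card_gt0P; exists (Sub v vX).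
(* Here [z] may lie in [X], so [linked] also records that it survives the deletion. *)
pose linked (z : G) (v : induced (~: X)) :=
  exists2 u, val u = z & connect (@adj (induced (~: X))) v u.
have to_s : forall v : induced (~: X), (forall c, c \in X -> f (val v) < f c) ->
    linked s v.
  move=> v; have [m] := ubnP (f (val v)); elim: m v => // m IH v f_lt v_lt.
  have [vs|/down[w vw wv]] := eqVneq (val v) s; first by exists v.
  have wX : w \in ~: X.
    by rewrite inE; apply/negP => /v_lt; rewrite ltnNge (ltnW wv).
  have [||u us wu] := IH (Sub w wX).
  - by rewrite ltnS in f_lt; apply: leq_trans f_lt.
  - by move=> c /v_lt; apply: ltn_trans.
  by exists u => //; apply: connect_trans wu; apply: connect1.
have to_t : forall v : induced (~: X), (forall c, c \in X -> f c < f (val v)) ->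
    linked t v.
  (* The ascent mirrors the descent, with the distance to the maximum [M] as measure. *)
  pose M := \max_u f u.
  move=> v; have [m] := ubnP (M - f (val v)); elim: m v => // m IH v f_lt v_gt.
  have [vt|/up[w vw wv]] := eqVneq (val v) t; first by exists v.
  have wX : w \in ~: X.
    by rewrite inE; apply/negP => /v_gt; rewrite ltnNge (ltnW wv).
  have [||u ut wu] := IH (Sub w wX).
  - rewrite ltnS in f_lt; apply: leq_trans f_lt.
    by rewrite ltn_sub2l // (leq_trans wv) // leq_bigmax.
  - by move=> c /v_gt /ltn_trans; apply.
  by exists u => //; apply: connect_trans wu; apply: connect1.
have to_st v : linked s v \/ linked t v.
  have [/forall_inP|/forall_inPn[c cX]] := boolP [forall c in X, f (val v) < f c].
    by left; apply: to_s.
  rewrite -leqNgt leq_eqVlt => /orP[/eqP/f_inj eq_c|cv].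
    by have := valP v; rewrite -eq_c inE cX.
  (* [X] has at most one element, so having [c] below [v] settles all of [X]. *)
  right; apply: to_t => d dX.
  suff -> : d = c by [].
  by apply: (card_le1_eqP X_lt2).
have linked_connect z v w : linked z v -> linked z w ->
    connect (@adj (induced (~: X))) v w.
  move=> [u uz vu] [u' u'z wu]; apply: connect_trans vu _; rewrite symX.
  by rewrite (_ : u = u') //; apply: val_inj; rewrite uz.
have linked_connect2 v w : linked s v -> linked t w ->
    connect (@adj (induced (~: X))) v w.
  move=> [u us vu] [u' u't wu]; apply: connect_trans vu _.
  apply: connect_trans (_ : connect _ u' w); last by rewrite symX.
  (* Both ends of the edge [st] survive here, so it joins the two sides. *)
  by apply: connect1; rewrite /= /induced_adj us u't.
move=> v w; case: (to_st v) (to_st w) => [sv|tv] [sw|tw].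
- exact: linked_connect sv sw.
- exact: linked_connect2.
- by rewrite symX; apply: linked_connect2.
- exact: linked_connect tv tw.
Qed.

(** * Local constraints on a crumby coloring *)

Section CrumbyConstraints.
Variables (G : sgraph) (R : {set G}).
Hypothesis crR : crumby R.

(** If all three were blue, [v] would have two blue neighbours. *)
Lemma crumby_blue v u w :
  adj v u -> adj v w -> u != w -> [|| v \in R, u \in R | w \in R].
Proof.
case: crR => blue _ _ vu vw uw; apply/negPn/negP; rewrite !negb_or -!in_setC.
move=> /and3P[vB uB wB]; move: blue; rewrite leqNgt => /negP; apply.
pose V : induced (~: R) := Sub v vB.
pose U : induced (~: R) := Sub u uB.
pose W : induced (~: R) := Sub w wB.
apply: leq_trans (leq_bigmax V); rewrite /deg.
have <- : #|[set U; W]| = 2 by rewrite cards2 -val_eqE /= uw.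
by apply/subset_leq_card/subsetP => z; rewrite !inE => /orP[]/eqP ->.
Qed.

Lemma crumby_path4 a b c d :
    adj a b -> adj b c -> adj c d -> uniq [:: a; b; c; d] ->
  [|| a \notin R, b \notin R, c \notin R | d \notin R].
Proof.
case: crR => _ _ noP4 ab bc cd abcd; rewrite -!negb_and; apply/negP.
move=> /and4P[aR bR cR dR]; apply: noP4; exists a, b, c, d; split=> // z.
by rewrite !inE => /or4P[] /eqP ->.
Qed.

End CrumbyConstraints.

(** * Refuting clause sets by branching *)

(* A literal (v, b) says that the variable v has the value b. *)
Section Refutation.
Implicit Types (cs : seq (seq (nat * bool))) (r : nat -> bool).

Definition satisfies r (c : seq (nat * bool)) := has (fun l => r l.1 == l.2) c.

(** A clause without [l] can involve its variable only through the opposite literal, which is now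
    false. *)
Definition assign (l : nat * bool) cs :=
  [seq [seq m <- c | m.1 != l.1] | c <- cs & l \notin c].

Lemma assign_sat r v cs :
  all (satisfies r) cs -> all (satisfies r) (assign (v, r v) cs).
Proof.
move=> /allP sat; apply/allP => _ /mapP[c /[!mem_filter] /andP[vc cs_c] ->].
have /hasP[[u b] uc /eqP /= ub] := sat c cs_c.
apply/hasP; exists (u, b); rewrite /= ?ub // mem_filter uc andbT /=.
by apply: contraNneq vc => <-; rewrite ub.
Qed.

(* Conditionals rather than && and ||, whose arguments vm_compute evaluates
   eagerly. *)
Fixpoint refute n vs cs :=
  if [::] \in cs then true else
  if n is n'.+1 then
    let v := if [seq c <- cs | size c == 1] is ((v, _) :: _) :: _ then v
             else head 0 vs in
    let vs' := rem v vs in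
    if refute n' vs' (assign (v, true) cs)
    then refute n' vs' (assign (v, false) cs) else false
  else false.

(** Any choice of branching variable is sound, since [r] agrees with one of the two assignments.
    Choosing the variable of a unit clause amounts to unit propagation: one branch contains the
    empty clause at once. *)
Lemma refuteP n vs cs r : refute n vs cs -> ~~ all (satisfies r) cs.
Proof.
elim: n vs cs => [|n IH] vs cs /=; case: ifP => [nil_cs _|_] //.
- by apply/negP => /allP/(_ _ nil_cs).
- by apply/negP => /allP/(_ _ nil_cs).
set v := (X in assign (X, true)).
case: ifP => // /IH rT /IH rF; apply/negP => /(@assign_sat r v).
by case: (r v); [exact/negP | exact/negP].
Qed.

End Refutation.

(** * Clausal form of crumbiness, over vertex numbers so that it can be computed *)

Section CrumbyClauses.
Variables (n : nat) (nbr : nat -> seq nat).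

(** [u < w] here and [a < d] in [path4_clauses] keep one of two symmetric copies of each clause. *)
Definition blue_clauses :=
  flatten [seq flatten [seq [seq [:: (v, true); (u, true); (w, true)]
    | w <- nbr v & u < w] | u <- nbr v] | v <- iota 0 n].

Definition red_clauses :=
  [seq (v, false) :: [seq (u, true) | u <- nbr v] | v <- iota 0 n].

Definition path4_clauses :=
  flatten [seq flatten [seq flatten [seq
    [seq [:: (a, false); (b, false); (c, false); (d, false)]
    | d <- nbr c & uniq [:: a; b; c; d] && (a < d)]
    | c <- nbr b] | b <- nbr a] | a <- iota 0 n].

Definition crumby_clauses := blue_clauses ++ red_clauses ++ path4_clauses.

Variables (G : sgraph) (e : nat -> G) (R : {set G}).
Hypothesis e_inj : {in gtn n &, injective e}.
Hypothesis nbr_lt : forall i j, i < n -> j \in nbr i -> j < n.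
Hypothesis nbr_adj : forall i j, i < n -> j \in nbr i -> adj (e i) (e j).
Hypothesis adj_nbr :
  forall i w, i < n -> adj (e i) w -> exists2 j, j \in nbr i & e j = w.
Hypothesis crR : crumby R.
Let red i := e i \in R.

Lemma blue_clauses_sat : all (satisfies red) blue_clauses.
Proof.
apply/allP => C /flatten_mapP[v]; rewrite mem_iota => /= v_lt.
case/flatten_mapP=> u vu /mapP[w]; rewrite mem_filter => /andP[uw vw] ->.
rewrite /satisfies /= !eqb_id orbF.
apply: (crumby_blue crR (nbr_adj v_lt vu) (nbr_adj v_lt vw)).
apply: contraTneq uw => /e_inj -> //; last exact: nbr_lt vw.
- by rewrite ltnn.
- exact: nbr_lt vu.
Qed.

Lemma red_clauses_sat : all (satisfies red) red_clauses.
Proof.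
have [_ red_nbr _] := crR.
apply/allP => C /mapP[v]; rewrite mem_iota => /= v_lt ->.
rewrite /satisfies /= eqbF_neg -implybE; apply/implyP => /red_nbr[w wR].
move=> /(adj_nbr v_lt)[j vj jw]; apply/hasP; exists (j, true).
  exact: map_f.
by rewrite /= /red jw wR.
Qed.

Lemma path4_clauses_sat : all (satisfies red) path4_clauses.
Proof.
apply/allP => C /flatten_mapP[a]; rewrite mem_iota => /= a_lt.
case/flatten_mapP=> b ab /flatten_mapP[c bc] /mapP[d].
rewrite mem_filter => /andP[/andP[abcd _] cd] ->.
have b_lt := nbr_lt a_lt ab; have c_lt := nbr_lt b_lt bc.
have d_lt := nbr_lt c_lt cd.
rewrite /satisfies /= !eqbF_neg orbF.
apply: (crumby_path4 crR); try exact: nbr_adj.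
rewrite -[X in uniq X]/(map e [:: a; b; c; d]) map_inj_in_uniq //.
apply: sub_in2 e_inj; apply/allP.
by rewrite /= !inE a_lt b_lt c_lt d_lt.
Qed.

Lemma crumby_clauses_sat : all (satisfies red) crumby_clauses.
Proof.
by rewrite !all_cat blue_clauses_sat red_clauses_sat path4_clauses_sat.
Qed.

End CrumbyClauses.

(** * The certificates for [G40] *)

Definition nbrs (u : nat) : seq nat :=
  [seq p.2 | p <- G40_edges & p.1 == u] ++ [seq p.1 | p <- G40_edges & p.2 == u].

Arguments nbrs : simpl never.

Lemma adj_nbrs (u v : G40) : adj u v = (val v \in nbrs (val u)).
Proof.
rewrite /= /G40_adj mem_cat; congr (_ || _); apply/idP/mapP => [uv|].
- by exists (val u, val v); rewrite ?mem_filter ?eqxx.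
- by case=> -[a b] /[!mem_filter] /= /andP[/eqP -> ab] ->.
- by exists (val v, val u); rewrite ?mem_filter ?eqxx.
- by case=> -[a b] /[!mem_filter] /= /andP[/eqP -> ab] ->.
Qed.

Lemma nbrs_lt u v : v \in nbrs u -> v < 40.
Proof.
have /allP small : all (fun p => (p.1 < 40) && (p.2 < 40)) G40_edges.
  by vm_compute.
by rewrite mem_cat => /orP[] /mapP[p /[!mem_filter] /andP[_ /small /andP[? ?]] ->].
Qed.

Lemma adj_inord u v : u < 40 -> v \in nbrs u -> adj (inord u : G40) (inord v).
Proof. by move=> u_lt uv; rewrite adj_nbrs /= !inordK // (nbrs_lt uv). Qed.

Lemma all_ord (P : pred nat) : all P (iota 0 40) -> forall v : G40, P (val v).
Proof. by move=> /allP allP v; apply: allP; rewrite mem_iota /= ltn_ord. Qed.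

(** Replaces cardinals of vertex sets by lengths of lists, which [vm_compute] can evaluate. *)
Lemma card_le_size (A : {set G40}) (s : seq nat) :
  (forall v, v \in A -> val v \in s) -> #|A| <= size s.
Proof.
move=> As; rewrite cardE -(size_map val); apply: uniq_leq_size.
  by rewrite map_inj_uniq ?enum_uniq //; apply: val_inj.
by move=> _ /mapP[v /[!mem_enum] /As vs ->].
Qed.

Lemma index_val_inj (s : seq nat) : all [in s] (iota 0 40) ->
  injective (fun v : G40 => index (val v) s).
Proof.
move=> /all_ord s_full u v eq_i; apply: val_inj.
by rewrite -(nth_index 0 (s_full u)) eq_i nth_index ?s_full.
Qed.

Lemma G40_subcubic : subcubic G40.
Proof.
apply/bigmax_leqP => v _; apply: leq_trans (card_le_size (s := nbrs (val v)) _) _.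
  by move=> w; rewrite inE adj_nbrs.
have: all (fun v => size (nbrs v) <= 3) (iota 0 40) by vm_compute.
by move/all_ord; apply.
Qed.

(* For the edge 0-1. *)
Definition st_order : seq nat :=
  [:: 0; 39; 33; 35; 38; 37; 36; 34; 32; 31; 30; 23; 25; 27; 29; 28; 26; 24; 22;
      11; 13; 15; 17; 19; 21; 20; 18; 16; 14; 12; 2; 4; 6; 8; 10; 9; 7; 5; 3; 1].

Lemma G40_2connected : k_connected 2 G40.
Proof.
pose f v := index v st_order.
(* Serves both directions: [c] is the exempt end, [s] or [t], and [e] compares positions. *)
have neighbour (c : nat) (e : rel nat) :
    all (fun v => (v == c) || has (e v) (nbrs v)) (iota 0 40) ->
    forall v : G40, v != inord c -> exists2 w : G40, adj v w & e (val v) (val w).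
  move=> /all_ord chk v vc; have /orP[/eqP v_c|/hasP[w vw evw]] := chk v.
    by move: vc; rewrite -v_c inord_val eqxx.
  exists (Ordinal (nbrs_lt vw)); last exact: evw.
  by rewrite adj_nbrs; exact: vw.
apply: (@st_numbering_2connected G40 (f \o val) (inord 0) (inord 1)).
- by rewrite card_ord.
- by apply: index_val_inj; vm_compute.
- exact: adj_inord.
- by apply: (neighbour 0 (fun v w => f w < f v)); vm_compute.
- by apply: (neighbour 1 (fun v w => f v < f w)); vm_compute.
Qed.

(* An elimination order of width 2; the set attached to the vertex at position
   i consists of the positions from [nth 0 elim_start i] to i. *)
Definition elim_order : seq nat :=
  [:: 10; 9; 8; 7; 6; 5; 4; 3; 2; 1; 0; 21; 20; 19; 18; 17; 16; 15; 14; 13;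
      12; 11; 29; 28; 27; 26; 25; 24; 23; 22; 30; 38; 37; 36; 35; 34; 33; 32;
      31; 39].

Definition elim_start : seq nat :=
  nseq 11 0 ++ nseq 9 11 ++ nseq 2 0 ++ nseq 7 22 ++ nseq 2 0 ++ nseq 7 31 ++
  nseq 2 0.

(** Each [D t] is an interval of [elim_order] ending at [t]; the computed list [bd t] contains its
    boundary and has at most two entries, all later than [t]. *)
Lemma G40_K4_minor_free : ~ minor (complete 4) G40.
Proof.
pose f v := index v elim_order.
pose inD t u := nth 0 elim_start (f t) <= f u <= f t.
pose bd t := [seq v <- iota 0 40 | ~~ inD t v && has (inD t) (nbrs v)].
pose D (t : G40) : {set G40} := [set u : G40 | inD (val t) (val u)].
have bdP t v : v \in boundary (D t) -> val v \in bd (val t).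
  rewrite !inE mem_filter mem_iota /= ltn_ord andbT => /andP[-> /exists_inP[u]].
  rewrite inE => ut uv; apply/hasP; exists (val u) => //.
  by rewrite -adj_nbrs adj_sym.
apply: (@complete_minor_free G40 (f \o val) D).
- by apply: index_val_inj; vm_compute.
- move=> t; rewrite inE.
  have: all (fun t => inD t t) (iota 0 40) by vm_compute.
  by move/all_ord; apply.
- by move=> t u; rewrite inE => /andP[].
- move=> t u /bdP.
  have: all (fun t => all (fun v => f t < f v) (bd t)) (iota 0 40).
    by vm_compute.
  by move/all_ord/(_ t)/allP; apply.
- move=> t; apply: leq_trans (card_le_size (bdP t)) _.
  have: all (fun t => size (bd t) <= 2) (iota 0 40) by vm_compute.
  by move/all_ord; apply.
Qed.

(* Found by local search to keep the search tree small; once these variables are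
   assigned, unit propagation always reaches a conflict. *)
Definition branching_order : seq nat :=
  [:: 36; 35; 33; 34; 32; 7; 8; 6; 5; 4; 31; 25; 24; 26; 39; 27; 23; 3; 14; 17;
      22; 16; 18; 19].

(** Each level of the search assigns one variable, so depth 40 is enough. *)
Lemma G40_refutation :
  refute 40 branching_order (crumby_clauses 40 nbrs).
Proof. by vm_compute. Qed.

Lemma G40_no_crumby : ~ exists R : {set G40}, crumby R.
Proof.
case=> R crR; have /negP := refuteP (fun i => inord i \in R) G40_refutation.
apply; apply: crumby_clauses_sat crR.
- by move=> i j i_lt j_lt /(congr1 val); rewrite /= !inordK.
- by move=> i j _; apply: nbrs_lt.
- by move=> i j; apply: adj_inord.
move=> i w i_lt; rewrite adj_nbrs [val (inord i)]inordK // => iw.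
by exists (val w); rewrite ?inord_val.
Qed.

Theorem theorem4 :
  [/\ subcubic G40,
      k_connected 2 G40,
      ~ minor (complete 4) G40
    & ~ exists R : {set G40}, crumby R].
Proof.
split; [exact: G40_subcubic | exact: G40_2connected
       | exact: G40_K4_minor_free | exact: G40_no_crumby].
Qed.
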